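(* Let $\{g_n\}_{n\in\mathbb{N}_0}\subset\mathrm{G}$ with $\Vert g_0-g_n\Vert_{\mathbb{R}_+^2}\xrightarrow{n\to\infty}0$. For $n\in\mathbb{N}$ let $\varphi_n\in\Phi$ be the unique global solution of the initial value problem $x'=n\,g_n(t,x)$, $x(0)=0$, and let $\overline{\varphi}_0\in\overline{\Phi}$ be defined by $\overline{\varphi}_0(t):=\inf\{x>0:g_0(t,x)<0\}$ (so that $d_{\overline{\Phi}}(\varphi_n,\overline{\varphi}_0)\xrightarrow{n\to\infty}0$). Fix $w\in C(\mathbb{R}_+,\mathbb{R})$. Define $\{\varepsilon_n\}_{n\in\mathbb{N}}\subset\mathrm{E}$ by the singletons $\varepsilon_n(t):=\{(w\circ\varphi_n)(t)\}$, and $\varepsilon_0:=w\bullet\overline{\varphi}_0\in\mathrm{E}$. Then $d_{\mathrm{E}}(\varepsilon_n,\varepsilon_0)\xrightarrow{n\to\infty}0$.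
   Context: $\mathbb{R}_+=[0,\infty)$. $\mathrm{G}\subset C(\mathbb{R}_+^2,\mathbb{R})$ is the set of continuous $g:\mathbb{R}_+^2\to\mathbb{R}$, $(t,x)\mapsto g(t,x)$, such that: (i) $g(0,0)\ge0$; (ii) $g(\cdot,x)$ is strictly increasing for each $x\in\mathbb{R}_+$; (iii) $\inf_{x\in\mathbb{R}_+}g(t,x)<0$ for all $t\in\mathbb{R}_+$; (iv) $\sup_{t\in\mathbb{R}_+}g(t,x)>0$ for all $x\in\mathbb{R}_+$. $\Vert g\Vert_{\mathbb{R}_+^2}:=\sum_{n\in\mathbb{N}}2^{-n}(1\wedge\sup_{[0,n]^2}|g|)$ and $\Vert w\Vert_{\mathbb{R}_+}:=\sum_{n\in\mathbb{N}}2^{-n}(1\wedge\sup_{[0,n]}|w|)$. $\Phi$ is the set of bijective paths in $C^1_0(\mathbb{R}_+,\mathbb{R}_+)$ (continuously differentiable bijections of $\mathbb{R}_+$ starting from $0$); for $g\in\mathrm{G}$ the problem $x'=g(t,x)$, $x(0)=0$ has a unique global solution, lying in $\Phi$. $\overline{\Phi}\supset\Phi$ is the set of strictly increasing càdlàg paths in $D(\mathbb{R}_+,\mathbb{R}_+)$ tending to $\infty$, with metric $d_{\overline{\Phi}}(\overline{\varphi}_1,\overline{\varphi}_2):=\Vert E(\overline{\varphi}_2)-E(\overline{\varphi}_1)\Vert_{\mathbb{R}_+}$, where $E(\overline{\varphi})(x):=\inf\{t>0:\overline{\varphi}(t)>x\}$. For $w\in C(\mathbb{R}_+,\mathbb{R})$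 and $\overline{\varphi}\in\overline{\Phi}$, $(w\bullet\overline{\varphi})(t):=\{w(x):x\in[\overline{\varphi}(t_-),\overline{\varphi}(t)]\}$, where $\overline{\varphi}(t_-):=\lim_{s\uparrow t}\overline{\varphi}(s)$ for $t>0$ and $\overline{\varphi}(0_-):=0$. $\mathrm{E}$ is the set of maps $\varepsilon$ assigning to each $t\in\mathbb{R}_+$ a nonempty compact interval $\varepsilon(t)\subset\mathbb{R}$ (possibly a singleton). For $T\in\mathbb{R}_+$ set $\Gamma_T(\varepsilon):=\{(t,x)\in[0,T]\times\mathbb{R}:x\in\varepsilon(t)\}$ and $\Gamma^*_T(\varepsilon):=\Gamma_T(\varepsilon)\cup(\{T\}\times\mathbb{R})$. Let $d_{\mathrm{E},T}(\varepsilon_1,\varepsilon_2)$ be the Hausdorff distance (w.r.t. the Euclidean norm) between $\Gamma_1:=\Gamma^*_T(\varepsilon_1)$ and $\Gamma_2:=\Gamma^*_T(\varepsilon_2)$, i.e. $\max\{\sup_{a\in\Gamma_1}\inf_{b\in\Gamma_2}|a-b|,\ \sup_{a\in\Gamma_2}\inf_{b\in\Gamma_1}|a-b|\}$. Then $d_{\mathrm{E}}(\varepsilon_1,\varepsilon_2):=\sum_{n\in\mathbb{N}}2^{-n}(1\wedge d_{\mathrm{E},n}(\varepsilon_1,\varepsilon_2))$ (a pseudometric). *)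

(* Defs.v *)
From HB Require Import structures.
From mathcomp Require Import all_boot all_order all_algebra.
From mathcomp Require Import all_classical all_reals all_analysis.

Set Implicit Arguments.
Unset Strict Implicit.
Unset Printing Implicit Defensive.

Import Order.TTheory GRing.Theory Num.Theory.
Import numFieldNormedType.Exports.

Local Open Scope classical_set_scope.
Local Open Scope ring_scope.

(* Functions on R_+ (resp. R_+^2) are represented by functions on R (resp.
   R * R); every notion below only looks at their values on R_+ (resp. R_+^2). *)
Section defs.
Context {R : realType}.

Definition Rplus : set R := [set t | 0 <= t].

Definition Rplus2 : set (R * R) := Rplus `*` Rplus.

Definition C_Rplus : set (R -> R) := [set w : R -> R | {within Rplus, continuous w}].

(* The extrema are taken in \bar R, as they may be infinite. *)
Definition G : set (R * R -> R) := [set g : R * R -> R |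
  [/\ {within Rplus2, continuous g},
      0 <= g (0, 0),
      forall x, Rplus x ->
        {in Rplus &, {homo (fun t => g (t, x)) : s t / s < t}},
      forall t, Rplus t -> (ereal_inf [set (g (t, x))%:E | x in Rplus] < 0)%E
    & forall x, Rplus x -> (0 < ereal_sup [set (g (t, x))%:E | t in Rplus])%E]].

(* sum over n >= 1 of 2^-n (1 /\ a_n) *)
Definition wsum (a : nat -> \bar R) : \bar R :=
  (\sum_(1 <= n <oo) ((2 ^- n)%:E * mine 1 (a n)))%E.

Definition norm_Rplus (w : R -> R) : \bar R :=
  wsum (fun n => ereal_sup [set `|w x|%:E | x in `[0, n%:R]]).

Definition norm_Rplus2 (g : R * R -> R) : \bar R :=
  wsum (fun n => ereal_sup [set `|g p|%:E | p in `[0, n%:R] `*` `[0, n%:R]]).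

(* Derivative relative to R_+: one-sided at t = 0, the usual one at t > 0. *)
Definition has_deriv_Rplus (f : R -> R) (t l : R) : Prop :=
  (f s - f t) / (s - t) @[s --> within Rplus t^'] --> l.

Definition Phi : set (R -> R) := [set phi : R -> R |
  [/\ set_bij Rplus Rplus phi,
      phi 0 = 0
    & exists2 d : R -> R, C_Rplus d &
        forall t, Rplus t -> has_deriv_Rplus phi t (d t)]].

Definition global_solution (f : R * R -> R) (phi : R -> R) : Prop :=
  [/\ set_fun Rplus Rplus phi,
      phi 0 = 0
    & forall t, Rplus t -> has_deriv_Rplus phi t (f (t, phi t))].

Definition Phibar : set (R -> R) := [set phi : R -> R |
  [/\ set_fun Rplus Rplus phi,
      {in Rplus &, {homo phi : s t / s < t}},
      forall t, Rplus t -> phi s @[s --> t^'+] --> phi t,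
      forall t : R, 0 < t -> cvg (phi s @[s --> t^'-])
    & phi t @[t --> +oo] --> +oo]].

Definition Einv (phi : R -> R) (x : R) : R := inf [set t | 0 < t /\ x < phi t].

Definition dPhibar (phi1 phi2 : R -> R) : \bar R :=
  norm_Rplus (fun x => Einv phi2 x - Einv phi1 x).

Definition left_lim (phi : R -> R) (t : R) : R :=
  if t == 0 then 0 else lim (phi s @[s --> t^'-]).

Definition bullet (w phi : R -> R) (t : R) : set R :=
  w @` `[left_lim phi t, phi t].

Definition E : set (R -> set R) := [set eps : R -> set R | forall t, Rplus t ->
  [/\ eps t !=set0, compact (eps t) & is_interval (eps t)]].

(* The library norm on R * R is the max norm. *)
Definition eucl_dist (a b : R * R) : R :=
  Num.sqrt ((a.1 - b.1) ^+ 2 + (a.2 - b.2) ^+ 2).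

Definition hausdorff_dist (A B : set (R * R)) : \bar R :=
  maxe
    (ereal_sup [set ereal_inf [set (eucl_dist a b)%:E | b in B] | a in A])
    (ereal_sup [set ereal_inf [set (eucl_dist a b)%:E | b in A] | a in B]).

Definition Gamma (T : R) (eps : R -> set R) : set (R * R) :=
  [set p | 0 <= p.1 <= T /\ eps p.1 p.2].

Definition Gamma_star (T : R) (eps : R -> set R) : set (R * R) :=
  Gamma T eps `|` [set T] `*` [set: R].

Definition dET (T : R) (eps1 eps2 : R -> set R) : \bar R :=
  hausdorff_dist (Gamma_star T eps1) (Gamma_star T eps2).

Definition dE (eps1 eps2 : R -> set R) : \bar R :=
  wsum (fun n => dET n%:R eps1 eps2).

Definition phibar0 (g0 : R * R -> R) (t : R) : R :=
  inf [set x | 0 < x /\ g0 (t, x) < 0].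

End defs.

(* Main.v *)
Require Import Defs.
From HB Require Import structures.
From mathcomp Require Import all_boot all_order all_algebra.
From mathcomp Require Import all_classical all_reals all_analysis.
From mathcomp Require Import lra.

Set Implicit Arguments.
Unset Strict Implicit.
Unset Printing Implicit Defensive.

Import Order.TTheory GRing.Theory Num.Theory.
Import numFieldNormedType.Exports.

Local Open Scope classical_set_scope.
Local Open Scope ring_scope.

(* Write f for phibar0 (g 0). Where g_n is negative the n-th solution cannot
   cross upwards, and where g_n >= m > 0 it moves with speed at least n * m; hence
   eventually phi_n(t) < c whenever f(t) < c, and f(s) < phi_n(t) whenever s < t.
   By monotonicity, finitely many grid times upgrade this to
     f(t) <= phi_n(t + e) and phi_n(t) <= f(t + e) for all t in [0, T].
   Consequently the times at which phi_n and the filled graph of f reach a given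
   level x differ by at most e. This bounds the distance of the inverses, and it
   also bounds the Hausdorff distance: points (t, w x) are matched horizontally at
   the same level x, so no modulus of continuity of w enters. *)

(** Merges the first terms of a weighted series, and later the finitely many grid times. *)
Lemma near_leq (P : nat -> nat -> Prop) :
  (forall k, \forall n \near \oo, P k n) ->
  forall K, \forall n \near \oo, forall k, (k <= K)%N -> P k n.
Proof.
move=> hP; elim=> [|K IH].
  by apply: filterS (hP 0%N) => n Pn k; rewrite leqn0 => /eqP ->.
apply: filterS2 IH (hP K.+1) => n IH Pn k.
by rewrite leq_eqVlt => /predU1P[->//|]; rewrite ltnS; exact: IH.
Qed.

(** * Convergence to 0 of capped series with weights 2^-n *)

Section weighted_sums.
Context {R : realType}.
Implicit Types (u : nat -> \bar R) (a : nat -> nat -> \bar R).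

Lemma cvge0P u : (forall n, 0 <= u n)%E ->
  (u n @[n --> \oo] --> 0%E <->
   forall e : R, 0 < e -> \forall n \near \oo, (u n <= e%:E)%E).
Proof.
move=> u0; split.
  move=> /fine_cvgP[ufin /cvgrPdist_le u_cvg] e e0.
  near=> n.
  have un : u n \is a fin_num by near: n.
  rewrite -(fineK un) lee_fin (le_trans (ler_norm _))// -normrN -sub0r.
  by near: n; exact: u_cvg.
move=> ule; apply/fine_cvgP; split.
  near=> n; rewrite ge0_fin_numE//.
  apply: (@le_lt_trans _ _ 1%:E); last exact: ltry.
  by near: n; exact: ule.
apply/cvgrPdist_le => e e0; near=> n.
have un : (u n <= e%:E)%E by near: n; exact: ule.
rewrite sub0r normrN ger0_norm ?fine_ge0//=.
rewrite -lee_fin fineK// ge0_fin_numE//.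
exact: le_lt_trans un (ltry _).
Unshelve. all: by end_near. Qed.

Let term (b : nat -> \bar R) n : \bar R := ((2 ^- n)%:E * mine 1 (b n))%E.

Let term_ge0 b n : (forall k, 0 <= b k)%E -> (0 <= term b n)%E.
Proof.
by move=> b0; rewrite mule_ge0 ?lee_fin// le_min lee01 b0.
Qed.

Lemma wsum_ge0 (b : nat -> \bar R) : (forall k, 0 <= b k)%E -> (0 <= wsum b)%E.
Proof. by move=> b0; apply: nneseries_ge0 => k _ _; exact: term_ge0. Qed.

Lemma wsum_cvg0_pointwise a (k : nat) (e : R) : (forall n k, 0 <= a n k)%E ->
  wsum (a n) @[n --> \oo] --> 0%E -> (0 < k)%N -> 0 < e ->
  \forall n \near \oo, (a n k <= e%:E)%E.
Proof.
move=> a0 /(cvge0P (fun n => wsum_ge0 (a0 n))).1 ha k0 e0.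
(* The factor [1 / 2] keeps the bound on [mine 1 (a n k)] below the cap 1, so the minimum has to be
   [a n k] itself. *)
set d := 2 ^- k * Num.min (e / 2) (1 / 2).
have p0 : (0 : R) < 2 ^- k by rewrite invr_gt0 exprn_gt0.
have d0 : 0 < d by rewrite mulr_gt0// lt_min !divr_gt0.
have {}ha : \forall n \near \oo, (wsum (a n) <= d%:E)%E by exact: ha.
near=> n.
have : (term (a n) k <= d%:E)%E.
  apply: le_trans (_ : (wsum (a n) <= _)%E); last by near: n.
  apply: le_trans (@nneseries_lim_ge _ (term (a n)) xpredT 1 k.+1 _); last first.
    by move=> *; exact: term_ge0.
  rewrite big_nat_recr//= leeDr//.
  by apply: sume_ge0 => i _; exact: term_ge0.
rewrite /term /d EFinM lee_pmul2l//.
rewrite ge_min => /orP[|h].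
  by rewrite lee_fin le_min => /andP[_ ?]; exfalso; lra.
apply: le_trans h _; rewrite lee_fin.
rewrite ge_min; apply/orP; left; lra.
Unshelve. all: by end_near. Qed.

(** A term of index k <= K costs at most e * 2^-k, a later one at most 2^-k because of the cap. The
    bound adds both geometric sums in closed form, the first one running up to [m], so that
    induction on [m] applies. *)
Let partial_sum (b : nat -> \bar R) (K m : nat) (e : R) : 0 <= e ->
  (forall k, 0 <= b k)%E ->
  (forall k, (0 < k <= K)%N -> (b k <= e%:E)%E) ->
  (\sum_(1 <= k < m.+1) term b k <= (e * (1 - 2 ^- m) +
    if (K <= m)%N then 2 ^- K - 2 ^- m else 0)%:E)%E.
Proof.
move=> e0 b0 be; elim: m => [|m IH].
  rewrite big_geq// expr0 invr1 subrr mulr0 add0r lee_fin.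
  by case: ifP => //; rewrite leqn0 => /eqP->; rewrite expr0 invr1 subrr.
rewrite big_nat_recr//=; apply: le_trans (leeD IH (lexx _)) _.
have p0 : (0 : R) < 2 ^- m.+1 by rewrite invr_gt0 exprn_gt0.
have pS : 2 ^- m = 2 * 2 ^- m.+1 :> R.
  by rewrite exprS invfM mulrA divff// mul1r.
have [Km|mK] := leqP K m; rewrite ?(leqW Km).
  apply: le_trans (leeD (lexx _) (_ : (_ <= (2 ^- m.+1)%:E)%E)) _.
    by rewrite /term -[leRHS]mule1 lee_pmul2l ?lte_fin// ge_min lexx.
  rewrite -EFinD lee_fin pS; nra.
apply: le_trans (leeD (lexx _) (_ : (_ <= (2 ^- m.+1 * e)%:E)%E)) _.
  rewrite /term EFinM lee_pmul2l ?lte_fin//.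
  by apply: (le_trans _ (be m.+1 _)); rewrite ?ge_min ?lexx ?orbT.
rewrite -EFinD lee_fin pS.
have [Km|_] := leqP K m.+1; last nra.
have -> : K = m.+1 by apply/eqP; rewrite eqn_leq Km mK.
nra.
Qed.

Lemma wsum_cvg0 a : (forall n k, 0 <= a n k)%E ->
  (forall (k : nat) (e : R), 0 < e -> \forall n \near \oo, (a n k <= e%:E)%E) ->
  wsum (a n) @[n --> \oo] --> 0%E.
Proof.
move=> a0 ha; apply/cvge0P => [n|e e0]; first exact: wsum_ge0.
(* Half of [e] pays for the tail beyond [K], the other half for the terms up to [K]. *)
have [K hK] : exists K : nat, 2 ^- K <= e / 2.
  have : (2^-1 : R) ^+ n @[n --> \oo] --> (0 : R).
    by apply: cvg_expr; rewrite ger0_norm//; lra.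
  move=> /cvgrPdist_le/(_ (e / 2) (divr_gt0 e0 (ltr0n _ 2)))[K _].
  move=> /(_ K (leqnn K)) /=; rewrite sub0r normrN => h.
  by exists K; rewrite -exprVn; exact: le_trans (ler_norm _) h.
have hn : \forall n \near \oo, forall k, (k <= K)%N -> (a n k <= (e / 2)%:E)%E.
  by apply: near_leq => k; apply: ha; rewrite divr_gt0.
near=> n.
apply: lime_le; first by apply: is_cvg_nneseries => k _ _; exact: term_ge0.
exists 1%N => // -[//|m] _.
apply: le_trans (@partial_sum (a n) K m (e / 2) _ _ _) _ => //.
- by rewrite divr_ge0// ltW.
- by move=> k /andP[_ kK]; move: k kK; near: n.
have pm : (0 : R) < 2 ^- m by rewrite invr_gt0 exprn_gt0.
rewrite lee_fin; case: ifP => _; nra.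
Unshelve. all: by end_near. Qed.

End weighted_sums.

(** * The path of first crossings of [g (t, .)] into negative values *)

Section phibar0.
Context {R : realType}.
Variable g : R * R -> R.
Hypothesis Gg : G g.
Implicit Types s t x y c e : R.

Lemma G_near t x e : 0 <= t -> 0 <= x -> 0 < e ->
  exists2 d : R, 0 < d & forall s y, 0 <= s -> 0 <= y ->
    `|s - t| < d -> `|y - x| < d -> `|g (s, y) - g (t, x)| < e.
Proof.
move=> t0 x0 e0; have [cg _ _ _ _] := Gg.
have /subspace_continuousP/(_ (t, x) (conj t0 x0))/cvgrPdist_lt/(_ _ e0) := cg.
rewrite near_withinE => /nbhs_ballP[d /= d0 hd]; exists d => // s y s0 y0 st yx.
by rewrite distrC; apply: hd => //; split; rewrite /= /ball/= distrC.
Qed.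

Lemma G_lt_time s t x : 0 <= s -> s < t -> 0 <= x -> g (s, x) < g (t, x).
Proof.
move=> s0 st x0; have [_ _ + _ _] := Gg.
by apply => //; rewrite inE/= /Rplus/= ?s0// (le_trans s0)// ltW.
Qed.

Lemma G_le_time s t x : 0 <= s -> s <= t -> 0 <= x -> g (s, x) <= g (t, x).
Proof.
move=> s0; rewrite le_eqVlt => /predU1P[->//|st] x0.
by rewrite ltW// G_lt_time.
Qed.

Lemma G_boundary_ge0 t : 0 <= t -> 0 <= g (t, 0).
Proof.
move=> t0; have [_ g00 _ _ _] := Gg.
by apply: le_trans g00 _; exact: G_le_time.
Qed.

Lemma G_neg t : 0 <= t -> exists2 x, 0 < x & g (t, x) < 0.
Proof.
move=> t0; have [_ _ _ + _] := Gg.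
move=> /(_ t t0)/ereal_inf_lt[_ [x x0 <-]]; rewrite lte_fin => gx.
exists x => //; rewrite lt_neqAle x0 andbT; apply: contraTN gx => /eqP <-.
by rewrite -leNgt; exact: G_boundary_ge0.
Qed.

Lemma G_pos x : 0 <= x -> exists2 t, 0 <= t & 0 < g (t, x).
Proof.
move=> x0; have [_ _ _ _ +] := Gg.
by move=> /(_ x x0)/ereal_sup_gt[_ [t t0 <-]]; rewrite lte_fin => gx; exists t.
Qed.

Lemma phibar0_ge0 t : 0 <= t -> 0 <= phibar0 g t.
Proof.
move=> t0; have [x x0 gx] := G_neg t0.
by apply: lb_le_inf; [exists x | move=> y [/ltW]].
Qed.

Lemma phibar0_le t x : 0 < x -> g (t, x) < 0 -> phibar0 g t <= x.
Proof.
by move=> x0 gx; apply: ge_inf => //; exists 0 => y [/ltW].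
Qed.

Lemma phibar0_below t x : 0 <= t -> 0 <= x -> x < phibar0 g t -> 0 <= g (t, x).
Proof.
move=> t0; rewrite le_eqVlt => /predU1P[<- _|x0]; first exact: G_boundary_ge0.
by apply: contraTT; rewrite -ltNge -leNgt; exact: phibar0_le.
Qed.

Lemma phibar0_lt t c : 0 <= t -> phibar0 g t < c ->
  exists x, [/\ 0 < x, phibar0 g t <= x, x < c & g (t, x) < 0].
Proof.
move=> t0 tc; have [x x0 gx] := G_neg t0.
have [||y [y0 gy] yc] := @inf_adherent R [set x | 0 < x /\ g (t, x) < 0]
    (c - phibar0 g t).
- by rewrite subr_gt0.
- by split; [exists x | exists 0 => z [/ltW]].
exists y; split => //; first exact: phibar0_le.
by apply: lt_le_trans yc _; rewrite /phibar0 addrC subrK.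
Qed.

(** If the value were positive, it would stay positive just above f, where [phibar0_lt] finds
    negative values. If it were negative, it would stay negative just below f, against
    [phibar0_below]. *)
Lemma phibar0_root t : 0 <= t -> g (t, phibar0 g t) = 0.
Proof.
move=> t0; have f0 := phibar0_ge0 t0; set f := phibar0 g t in f0 *.
apply/eqP; rewrite eq_le !leNgt; apply/andP; split; apply/negP => gf.
  have [d d0 hd] := G_near t0 f0 gf.
  have fd : phibar0 g t < f + d by rewrite ltrDl.
  have [x [x0 fx xd gx]] := phibar0_lt t0 fd.
  have := hd t x t0 (ltW x0); rewrite subrr normr0 => /(_ d0).
  rewrite ger0_norm ?subr_ge0// => /(_ _)/wrap[].
    by rewrite ltrBlDl.
  by rewrite ltr0_norm ?subr_lt0 ?(lt_trans gx)//; lra.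
have [f00|fN0] := eqVneq f 0.
  by move: gf; rewrite f00 ltNge G_boundary_ge0.
have fp : 0 < f by rewrite lt_neqAle eq_sym fN0.
have e0 : 0 < - g (t, f) by rewrite oppr_gt0.
have [d d0 hd] := G_near t0 f0 e0.
(* A point below [f] within distance [d]; the maximum with [f / 2] keeps it in R_+. *)
pose x := Num.max (f / 2) (f - d / 2).
have x0 : 0 <= x by rewrite le_max; apply/orP; left; lra.
have xf : x < f by rewrite gt_max; apply/andP; split; lra.
have xd : f - d / 2 <= x by rewrite le_max lexx orbT.
have gx := phibar0_below t0 x0 xf.
have := hd t x t0 x0; rewrite subrr normr0 => /(_ d0).
rewrite ltr0_norm ?subr_lt0// => /(_ _)/wrap[]; first lra.
by rewrite gtr0_norm ?subr_gt0 ?(lt_le_trans gf)//; lra.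
Qed.

(** A zero at x = 0 and time t > 0 would force g(0, 0) < 0 by strict growth in time. *)
Lemma phibar0_gt0 t : 0 < t -> 0 < phibar0 g t.
Proof.
move=> t0; rewrite lt_neqAle phibar0_ge0 ?(ltW t0)// andbT; apply/eqP => f0.
have := phibar0_root (ltW t0); rewrite -f0 => g0.
have := G_lt_time (lexx 0) t0 (lexx 0); rewrite g0 ltNge.
by rewrite G_boundary_ge0.
Qed.

(** The root at time t has become negative at the earlier time s; by continuity g(s, .) is also
    negative slightly to the left of it. *)
Lemma phibar0_lt_mono s t : 0 <= s -> s < t -> phibar0 g s < phibar0 g t.
Proof.
move=> s0 st; have t0 : 0 < t by exact: le_lt_trans st.
have f0 := phibar0_gt0 t0; set f := phibar0 g t in f0 *.
have e0 : 0 < - g (s, f).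
  by rewrite oppr_gt0 -(phibar0_root (ltW t0)) G_lt_time// ltW.
have [d d0 hd] := G_near s0 (ltW f0) e0.
pose x := Num.max (f / 2) (f - d / 2).
have x0 : 0 < x by rewrite lt_max; apply/orP; left; lra.
have xf : x < f by rewrite gt_max; apply/andP; split; lra.
have xd : f - d / 2 <= x by rewrite le_max lexx orbT.
apply: (le_lt_trans _ xf); apply: phibar0_le => //.
have := hd s x s0 (ltW x0); rewrite subrr normr0 => /(_ d0).
rewrite ltr0_norm ?subr_lt0// => /(_ _)/wrap[]; first lra.
by move=> /(le_lt_trans (ler_norm _)); lra.
Qed.

Lemma phibar0_le_mono s t : 0 <= s -> s <= t -> phibar0 g s <= phibar0 g t.
Proof.
move=> s0; rewrite le_eqVlt => /predU1P[->//|st].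
by rewrite ltW// phibar0_lt_mono.
Qed.

(** Let L be a finite supremum and g(t, L) > 0. Roots at times beyond t come arbitrarily close to L,
    and at time t the function g is <= 0 there, against continuity at (t, L). *)
Lemma phibar0_unbounded c : exists2 t, 0 <= t & c < phibar0 g t.
Proof.
apply: contrapT => /forall2NP hc.
have {}hc t : 0 <= t -> phibar0 g t <= c.
  by move=> t0; have [//|/negP] := hc t; rewrite -leNgt.
pose F := [set phibar0 g t | t in [set t | 0 <= t]].
have supF : has_sup F.
  by split; [exists (phibar0 g 0), 0 => //=|exists c => _ [t t0 <-]; exact: hc].
pose L := sup F.
have fL t : 0 <= t -> phibar0 g t <= L.
  by move=> t0; apply: ub_le_sup; [exact: supF.2|exists t].
have L0 : 0 <= L by exact: le_trans (phibar0_ge0 (lexx 0)) (fL 0 (lexx 0)).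
have [t t0 gt] := G_pos L0.
have [d d0 hd] := G_near t0 L0 gt.
have [_ [s s0 <-] fs] := sup_adherent d0 supF.
have m0 : 0 <= Num.max s t by rewrite le_max s0.
have sm : phibar0 g s <= phibar0 g (Num.max s t).
  by apply: phibar0_le_mono => //; rewrite le_max lexx.
have tm : g (t, phibar0 g (Num.max s t)) <= 0.
  rewrite -[leRHS](phibar0_root m0); apply: G_le_time => //.
    by rewrite le_max lexx orbT.
  exact: phibar0_ge0.
have := hd t _ t0 (phibar0_ge0 m0); rewrite subrr normr0 => /(_ d0).
rewrite -normrN ger0_norm opprB ?subr_ge0 ?fL// => /(_ _)/wrap[].
  rewrite -/L in fs; lra.
by rewrite -normrN => /(le_lt_trans (ler_norm _)); lra.
Qed.

(** Right continuity: a negative point of g(t, .) just above the root stays negative for slightly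
    later times and caps the path there. Left limits come from monotonicity. *)
Lemma phibar0_Phibar : Phibar (phibar0 g).
Proof.
split.
- by move=> t t0; exact: phibar0_ge0.
- by move=> s t; rewrite !inE => s0 _; exact: phibar0_lt_mono.
- move=> t t0; apply/cvgrPdist_lt => e e0.
  have fe : phibar0 g t < phibar0 g t + e by rewrite ltrDl.
  have [x [x0 fx xe gx]] := phibar0_lt t0 fe.
  have e1 : 0 < - g (t, x) by rewrite oppr_gt0.
  have [d d0 hd] := G_near t0 (ltW x0) e1.
  have td : t < t + d by rewrite ltrDl.
  near=> s.
  have ts : t < s by near: s; exact: nbhs_right_gt.
  have s0 : 0 <= s by exact: le_trans (ltW ts).
  have sd : s < t + d by near: s; exact: nbhs_right_lt.
  have fs : phibar0 g s <= x.
    apply: phibar0_le => //.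
    have := hd s x s0 (ltW x0); rewrite subrr normr0 gtr0_norm ?subr_gt0//.
    rewrite ltrBlDl => /(_ sd d0)/(le_lt_trans (ler_norm _)); lra.
  rewrite distrC ger0_norm ?subr_ge0 ?phibar0_le_mono ?(ltW ts)//; lra.
- move=> t t0.
  have r0 : \forall r \near t^'-, 0 <= r by exact: nbhs_left_ge.
  apply: nondecreasing_at_left_is_cvgr; apply: filterS r0 => r r0.
    move=> x y; rewrite !in_itv/= => /andP[rx _] _.
    exact: phibar0_le_mono (le_trans r0 (ltW rx)).
  exists (phibar0 g t) => y [x /=]; rewrite in_itv/= => /andP[rx xt] <-.
  exact: phibar0_le_mono (le_trans r0 (ltW rx)) (ltW xt).
- apply/cvgryPge => A; have [t t0 At] := phibar0_unbounded A.
  have : \forall s \near +oo, t <= s by apply: nbhs_pinfty_ge; exact: num_real.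
  by apply: filterS => s ts; exact: le_trans (ltW At) (phibar0_le_mono t0 ts).
Unshelve. all: by end_near. Qed.

End phibar0.

(** * Derivatives relative to the half-line *)

Section one_sided_derivative.
Context {R : realType}.
Implicit Types (f : R -> R) (s t l : R).

Lemma has_deriv_Rplus_near f t l e : 0 < e -> has_deriv_Rplus f t l ->
  exists2 d : R, 0 < d & forall s, 0 <= s -> s != t -> `|t - s| < d ->
    `|l - (f s - f t) / (s - t)| < e.
Proof.
move=> e0 /cvgrPdist_lt/(_ _ e0).
rewrite near_withinE => /nbhs_ballP[d /= d0 hd]; exists d => // s s0 st sd.
exact: hd.
Qed.

Lemma has_deriv_Rplus_continuous f (df : R -> R) :
  (forall t, Rplus t -> has_deriv_Rplus f t (df t)) ->
  {within Rplus, continuous f}.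
Proof.
move=> hf; apply/subspace_continuousP => t t0; apply/cvgrPdist_lt => e e0.
(* Tolerance 1 bounds the difference quotients near [t] by [|df t| + 1], a local Lipschitz constant
   at [t]. *)
have [d d0 hd] := has_deriv_Rplus_near ltr01 (hf t t0).
have k0 : 0 < `|df t| + 1 by rewrite ltr_pwDr.
rewrite near_withinE; apply/nbhs_ballP.
exists (Num.min d (e / (`|df t| + 1))); first by rewrite /= lt_min d0 divr_gt0.
move=> s /=; rewrite /ball/= lt_min ltr_pdivlMr// => /andP[sd se] s0.
have [->|st] := eqVneq s t; first by rewrite subrr normr0.
have := hd s s0 st sd; set q := _ / _ => hq.
have -> : f t - f s = q * (t - s).
  by rewrite -(opprB s t) mulrN divfK ?subr_eq0// opprB.
rewrite normrM; apply: le_lt_trans se; rewrite mulrC ler_wpM2l//.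
rewrite -lerBlDl (le_trans (lerB_dist _ _))// distrC; exact: ltW.
Qed.

Lemma has_deriv_Rplus_is_derive f t l : 0 < t -> has_deriv_Rplus f t l ->
  is_derive t 1 f l.
Proof.
move=> t0 hf.
suff h : (fun h => h^-1 *: (f (h *: 1 + t) - f t)) @ 0^' --> l.
  by apply: DeriveDef; [exact: cvgP h|exact: cvg_lim h].
apply/cvgrPdist_lt => e e0; have [d d0 hd] := has_deriv_Rplus_near e0 hf.
(* Radius at most [t] keeps the ball inside R_+, where the relative derivative is the usual one. *)
apply/nbhs_ballP; exists (Num.min d t); first by rewrite /= lt_min d0.
move=> h /=; rewrite /ball/= sub0r normrN lt_min => /andP[hdd ht] h0.
have := hd (h *: 1 + t); rewrite /GRing.scale/= mulr1 addrK.
rewrite [_ / h]mulrC; apply.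
- by move: ht; rewrite ltr_norml => /andP[? _]; lra.
- by rewrite -subr_eq0 addrK.
- by rewrite opprD addrCA subrr addr0 normrN.
Qed.

Lemma has_deriv_Rplus_ge0 f t l : 0 <= t ->
  {in Rplus &, {homo f : x y / x < y}} -> has_deriv_Rplus f t l -> 0 <= l.
Proof.
move=> t0 fmono hf; rewrite leNgt; apply/negP => l0.
have nl0 : 0 < - l by rewrite oppr_gt0.
have [d d0 hd] := has_deriv_Rplus_near nl0 hf.
have ts : t < t + d / 2 by rewrite ltrDl divr_gt0.
have s0 : 0 <= t + d / 2 by exact: le_trans (ltW ts).
have ft : f t < f (t + d / 2) by apply: fmono; rewrite ?inE.
have := hd _ s0 (negbT (gt_eqF ts)).
rewrite opprD addrA subrr sub0r normrN ger0_norm; last lra.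
move=> /(_ _)/wrap[]; first lra.
have q0 : 0 <= (f (t + d / 2) - f t) / (t + d / 2 - t).
  by rewrite divr_ge0// subr_ge0 ltW.
by rewrite ltr0_norm; lra.
Qed.

End one_sided_derivative.

(** * Continuity and monotonicity of paths in [Phi] *)

Section Phi_paths.
Context {R : realType}.
Variable phi : R -> R.
Hypothesis Phi_phi : Phi phi.

Lemma Phi_continuous : {within Rplus, continuous phi}.
Proof.
have [_ _ [d _ hd]] := Phi_phi; exact: has_deriv_Rplus_continuous hd.
Qed.

Lemma Phi_ge0 t : 0 <= t -> 0 <= phi t.
Proof. by have [[h _ _] _ _] := Phi_phi => t0; exact: h. Qed.

Lemma Phi_surj x : 0 <= x -> exists2 t, 0 <= t & phi t = x.
Proof. by have [[_ _ h] _ _] := Phi_phi => x0; exact: h. Qed.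

(** A continuous injection on an interval is monotone; [phi 0 = 0 <= phi 1] decides the
    direction. *)
Lemma Phi_lt_mono : {in Rplus &, {homo phi : s t / s < t}}.
Proof.
have I0 : [set` `[(0 : R), +oo[] = Rplus.
  by apply/seteqP; split => x; rewrite /Rplus/= in_itv/= andbT.
have memI x : (x \in `[(0 : R), +oo[) = (0 <= x) by rewrite in_itv/= andbT.
have hc : {within [set` `[(0 : R), +oo[], continuous phi}.
  by rewrite I0; exact: Phi_continuous.
have hi : {in `[(0 : R), +oo[ &, injective phi}.
  have [[_ inj _] _ _] := Phi_phi => s t; rewrite !memI => s0 t0.
  by apply: inj; rewrite inE.
have hx : exists x y : R, [/\ x \in `[0, +oo[, y \in `[0, +oo[, x < y & phi x <= phi y].
  exists 0, 1; rewrite !memI ler01 lexx ltr01; split => //.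
  by have [_ -> _] := Phi_phi; exact: Phi_ge0.
have mono := itv_continuous_inj_le hx hc hi.
move=> s t; rewrite !inE /Rplus/= => s0 t0.
by rewrite (leW_mono_in mono) ?memI.
Qed.

End Phi_paths.

(** * Upper and lower bounds for solutions of x' = k g(t, x) *)

Section comparison.
Context {R : realType}.
Variables (g : R * R -> R) (k : R) (phi : R -> R).
Hypotheses (Gg : G g) (k0 : 0 < k) (Phi_phi : Phi phi).
Hypothesis sol : global_solution (fun p => k * g p) phi.

(** Otherwise [phi] takes the value x at some s <= t, with speed k g(s, x) <= k g(t, x) < 0,
    although an increasing path has nonnegative derivative. *)
Lemma solution_below_barrier t x : 0 <= t -> 0 <= x -> g (t, x) < 0 -> phi t < x.
Proof.
move=> t0 x0 gx; rewrite ltNge; apply/negP => xp.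
have [s s0 sx] := Phi_surj Phi_phi x0.
have st : s <= t.
  rewrite leNgt; apply/negP => ts.
  have : phi t < phi s by apply: (Phi_lt_mono Phi_phi); rewrite ?inE.
  by rewrite sx ltNge xp.
have [_ _ /(_ s s0)] := sol.
move=> /(has_deriv_Rplus_ge0 s0 (Phi_lt_mono Phi_phi)).
rewrite pmulr_rge0// sx leNgt (le_lt_trans _ gx)//; exact: G_le_time.
Qed.

(** If [phi t <= c], the path stays in [0, c] on [r, t], where its speed is at least k m since g
    grows in time; the mean value theorem then carries it past c. *)
Lemma solution_above (r t c m : R) : 0 < r -> r < t -> 0 <= m ->
  (forall x, 0 <= x <= c -> m <= g (r, x)) -> c < k * m * (t - r) -> c < phi t.
Proof.
move=> r0 rt m0 gm ckm; rewrite ltNge; apply/negP => pc.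
have der x : x \in `]r, t[ -> is_derive x 1 phi (k * g (x, phi x)).
  rewrite in_itv/= => /andP[rx _]; have x0 := lt_trans r0 rx.
  by apply: has_deriv_Rplus_is_derive => //; have [_ _] := sol; apply; exact: ltW.
have cont : {within `[r, t], continuous phi}.
  apply: continuous_subspaceW (Phi_continuous Phi_phi) => x /=.
  by rewrite in_itv/= => /andP[rx _]; exact: le_trans (ltW r0) rx.
have [x] := MVT rt der cont; rewrite in_itv/= => /andP[rx xt] E.
have x0 := lt_trans r0 rx.
have px : phi x <= c.
  apply: le_trans pc; apply/ltW/(Phi_lt_mono Phi_phi); rewrite ?inE// /Rplus/=; lra.
have gx : m <= g (x, phi x).
  have p0 := Phi_ge0 Phi_phi (ltW x0).
  apply: le_trans (gm (phi x) _) _; first by rewrite p0.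
  by apply: G_le_time => //; lra.
have pr := Phi_ge0 Phi_phi (ltW r0).
have : k * m * (t - r) <= k * g (x, phi x) * (t - r).
  by rewrite ler_wpM2r ?subr_ge0 ?(ltW rt)// ler_wpM2l// ltW.
by rewrite -E; lra.
Qed.

End comparison.

(** * Left limits and generalized inverse of a path in [Phibar] *)

Section cadlag_paths.
Context {R : realType}.
Variable f : R -> R.
Hypothesis Phibar_f : Phibar f.
Implicit Types r s t x y : R.

Lemma Phibar_le_mono s t : 0 <= s -> s <= t -> f s <= f t.
Proof.
have [_ fmono _ _ _] := Phibar_f.
move=> s0; rewrite le_eqVlt => /predU1P[->//|st]; apply/ltW/fmono => //.
  by rewrite inE.
by rewrite inE; exact: le_trans (ltW st).
Qed.

Lemma Phibar_lt_mono s t : 0 <= s -> s < t -> f s < f t.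
Proof.
have [_ fmono _ _ _] := Phibar_f.
move=> s0 st; apply: fmono => //; rewrite inE//.
exact: le_trans (ltW st).
Qed.

Lemma Phibar_ge0 t : 0 <= t -> 0 <= f t.
Proof. by have [h _ _ _ _] := Phibar_f; exact: h. Qed.

Lemma Phibar_unbounded x : exists2 t, 0 < t & x < f t.
Proof.
have [_ _ _ _ /cvgryPgt/(_ x) fx] := Phibar_f.
have [t [t0 xt]] : exists t, 0 < t /\ x < f t.
  have t_gt0 : \forall t \near +oo, (0 : R) < t by exact: nbhs_pinfty_gt (num_real _).
  have [t [? ?]] := filter_ex (filterI t_gt0 fx).
  by exists t.
by exists t.
Qed.

Lemma le_left_lim r t : 0 <= r -> r < t -> f r <= left_lim f t.
Proof.
move=> r0 rt; have t0 : 0 < t by exact: le_lt_trans rt.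
have [_ _ _ /(_ t t0) cf _] := Phibar_f.
rewrite /left_lim gt_eqF//; apply: limr_ge => //.
have : \forall s \near t^'-, r < s by exact: nbhs_left_gt.
by apply: filterS => s rs; exact: Phibar_le_mono (ltW rs).
Qed.

(** The hypothesis [0 <= y] covers t = 0, where [left_lim] is 0 by convention and the condition on r
    is empty. *)
Lemma left_lim_le t y : 0 <= t -> 0 <= y ->
  (forall r, 0 <= r -> r < t -> f r <= y) -> left_lim f t <= y.
Proof.
rewrite /left_lim le_eqVlt => /predU1P[<- y0 _|t0 _ fy]; first by rewrite eqxx.
rewrite gt_eqF//; have [_ _ _ /(_ t t0) cf _] := Phibar_f.
apply: limr_le => //; apply: filterS2 (nbhs_left_ge t0) (nbhs_left_lt t) => s.
exact: fy.
Qed.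

Lemma left_lim_ge0 t : 0 <= t -> 0 <= left_lim f t.
Proof.
rewrite le_eqVlt => /predU1P[<-|t0]; first by rewrite /left_lim eqxx.
by apply: le_trans (le_left_lim (lexx 0) t0); exact: Phibar_ge0.
Qed.

Lemma left_lim_le_self t : 0 <= t -> left_lim f t <= f t.
Proof.
move=> t0; apply: left_lim_le => // [|r r0 rt]; first exact: Phibar_ge0.
exact: Phibar_le_mono (ltW rt).
Qed.

Lemma Einv_le t x : 0 < t -> x < f t -> Einv f x <= t.
Proof. by move=> t0 xt; apply: ge_inf => //; exists 0 => y [/ltW]. Qed.

Lemma Einv_ge0 x : 0 <= Einv f x.
Proof.
have [t t0 xt] := Phibar_unbounded x.
by apply: lb_le_inf; [exists t|move=> y [/ltW]].
Qed.

(** Every level y is met by the filled graph at time [Einv f y]: no earlier value exceeds y, later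
    ones do, and right continuity passes to the limit. *)
Lemma Einv_filled_graph y : 0 <= y ->
  left_lim f (Einv f y) <= y /\ y <= f (Einv f y).
Proof.
move=> y0; have s0 := Einv_ge0 y; set s := Einv f y in s0 *; split.
  apply: left_lim_le => // r r0 rs; rewrite leNgt; apply/negP => yr.
  (* [Einv] ranges over positive times only and [r] may be 0, hence the midpoint. *)
  have : s <= (r + s) / 2.
    apply: Einv_le; first lra.
    apply: lt_le_trans yr _; apply: Phibar_le_mono => //; lra.
  lra.
have [_ _ /(_ s s0) cf _ _] := Phibar_f.
apply: (cvgr_to_ge cf); apply: filterS (nbhs_right_gt s) => r sr.
have [t t0 yt] := Phibar_unbounded y.
have [||x [x0 yx] xr] := @inf_adherent R [set t | 0 < t /\ y < f t] (r - s).
- by rewrite subr_gt0.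
- by split; [exists t|exists 0 => z [/ltW]].
apply/ltW/(lt_le_trans yx)/Phibar_le_mono; first exact: ltW.
by move: xr; rewrite -/(Einv f y) -/s; lra.
Qed.

End cadlag_paths.

(** * Closeness of two increasing paths up to a time shift *)

Section interleaved_paths.
Context {R : realType}.
Variables f u : R -> R.
Hypotheses (Phibar_f : Phibar f) (Phi_u : Phi u).
Implicit Types s t x e T : R.

(** Closeness is measured along the time axis, as jumps of [f] rule out uniform closeness of values.
    Only forward shifts occur, so arguments never leave R_+. *)
Definition interleaved e T :=
  forall t, 0 <= t <= T -> f t <= u (t + e) /\ u t <= f (t + e).

Let interleaved_le e T t : interleaved e T -> 0 <= t -> t <= T ->
  f t <= u (t + e) /\ u t <= f (t + e).
Proof. by move=> fu t0 tT; apply: fu; rewrite t0. Qed.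

Let u_lt s t : 0 <= s -> s < t -> u s < u t.
Proof.
move=> s0 st; apply: (Phi_lt_mono Phi_u) => //; rewrite inE//.
exact: le_trans (ltW st).
Qed.

(** Once one path exceeds x, the other does so at most e later. Times beyond T are handled by
    comparison with T, since [f T] already exceeds x. *)
Lemma interleaved_Einv e T x : 0 < e -> 0 < T -> interleaved e T ->
  0 <= x -> x < f T -> `|Einv f x - Einv u x| <= e.
Proof.
move=> e0 T0 fu x0 xT.
have Eu_le t : 0 < t -> x < u t -> Einv u x <= t.
  by move=> t0 xt; apply: ge_inf => //; exists 0 => y [/ltW].
have [r r0 rx] : exists2 r, 0 < r & x < u r.
  exists (T + e); first lra.
  exact: lt_le_trans xT (interleaved_le fu (ltW T0) (lexx T)).1.
rewrite ler_distl; apply/andP; split.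
  rewrite lerBlDr -lerBlDr; apply: lb_le_inf.
    by exists T.
  move=> t [t0 xt]; rewrite lerBlDr.
  have [tT|Tt] := leP t T.
    apply: Eu_le; first lra.
    exact: lt_le_trans xt (interleaved_le fu (ltW t0) tT).1.
  apply: (@le_trans _ _ (T + e)); last lra.
  apply: Eu_le; first lra.
  exact: lt_le_trans xT (interleaved_le fu (ltW T0) (lexx T)).1.
rewrite -lerBlDr; apply: lb_le_inf; first by exists r.
move=> t [t0 xt]; rewrite lerBlDr.
have [tT|Tt] := leP t T.
  apply: (Einv_le _); first lra.
  exact: lt_le_trans xt (interleaved_le fu (ltW t0) tT).2.
by apply: (@le_trans _ _ T); [exact: Einv_le|lra].
Qed.

(** A gap larger than e contradicts interleaving at the smaller of the two times, so it suffices
    that one of them is at most T. *)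
Lemma interleaved_times e T s t : 0 < e -> interleaved e T -> 0 <= s -> 0 <= t -> (s <= T) || (t <= T) ->
  left_lim f s <= u t -> u t <= f s -> `|s - t| <= e.
Proof.
move=> e0 fu s0 t0 stT su us; rewrite ler_distl; apply/andP; split.
  rewrite leNgt; apply/negP => st.
  have sT : s <= T by case/orP: stT => //; lra.
  have : u (s + e) < u t by apply: u_lt; lra.
  have [h _] := interleaved_le fu s0 sT.
  lra.
rewrite leNgt; apply/negP => ts.
have tT : t <= T by case/orP: stT => //; lra.
(* The midpoint of t + e and s makes the comparison of [f (t + e)] with the left limit at s
   strict. *)
have te : t + e < (t + e + s) / 2 by lra.
have h1 : f (t + e) < f ((t + e + s) / 2) by apply: Phibar_lt_mono => //; lra.
have h2 : f ((t + e + s) / 2) <= left_lim f s by apply: le_left_lim => //; lra.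
have [_ h] := interleaved_le fu t0 tT.
lra.
Qed.

End interleaved_paths.

(** * Hausdorff distance via horizontal matching *)

Section hausdorff.
Context {R : realType}.
Implicit Types A B : set (R * R).

Lemma eucl_dist_horizontal (s t x : R) : eucl_dist (s, x) (t, x) = `|s - t|.
Proof. by rewrite /eucl_dist/= subrr expr0n/= addr0 sqrtr_sqr. Qed.

Lemma hausdorff_dist_ge0 A B : A !=set0 -> (0 <= hausdorff_dist A B)%E.
Proof.
move=> [a Aa]; rewrite le_max; apply/orP; left.
apply: (@le_trans _ _ (ereal_inf [set (eucl_dist a b)%:E | b in B])).
  by apply: le_ereal_inf_tmp => _ [b _ <-]; rewrite lee_fin sqrtr_ge0.
by apply: ereal_sup_ubound; exists a.
Qed.

Lemma hausdorff_dist_le A B (e : R) :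
  (forall a, A a -> exists2 b, B b & eucl_dist a b <= e) ->
  (forall b, B b -> exists2 a, A a & eucl_dist b a <= e) ->
  (hausdorff_dist A B <= e%:E)%E.
Proof.
move=> AB BA; rewrite ge_max; apply/andP; split; apply: ge_ereal_sup.
  move=> _ [a Aa <-]; have [b Bb ab] := AB a Aa.
  by apply: (@le_trans _ _ (eucl_dist a b)%:E) => //; apply: ereal_inf_lbound; exists b.
move=> _ [b Bb <-]; have [a Aa ab] := BA b Bb.
by apply: (@le_trans _ _ (eucl_dist b a)%:E) => //; apply: ereal_inf_lbound; exists a.
Qed.

Lemma dET_ge0 (T : R) eps1 eps2 : (0 <= dET T eps1 eps2)%E.
Proof. by apply: hausdorff_dist_ge0; exists (T, 0); right. Qed.

(* A point whose matching time exceeds T is matched with the vertical line {T} x R. *)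
Lemma dET_interleaved (f u w : R -> R) (e T : R) :
  Phibar f -> Phi u -> 0 < e -> 0 <= T ->
  interleaved f u e T ->
  (dET T (fun t => [set w (u t)]) (bullet w f) <= e%:E)%E.
Proof.
move=> Phf Phu e0 T0 fu; apply: hausdorff_dist_le => -[t y].
  move=> [[/= /andP[t0 tT] ->]|[/= -> _]]; last first.
    exists (T, y); first by right.
    by rewrite eucl_dist_horizontal subrr normr0 ltW.
  have ut0 := Phi_ge0 Phu t0.
  (* The level [u t] is matched at the time when the filled graph of [f] reaches it. *)
  have [ls us] := Einv_filled_graph Phf ut0.
  have s0 := Einv_ge0 Phf (u t); set s := Einv f (u t) in ls us s0 *.
  have st : `|s - t| <= e.
    by apply: (interleaved_times Phf Phu e0 fu) => //; rewrite tT orbT.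
  have [sT|Ts] := leP s T.
    exists (s, w (u t)); last by rewrite eucl_dist_horizontal distrC.
    by left; split => /=; [rewrite s0|exists (u t) => //=; rewrite in_itv/= ls].
  exists (T, w (u t)); first by right.
  rewrite eucl_dist_horizontal (le_trans _ st)// distrC !ger0_norm; lra.
move=> [[/= /andP[t0 tT] [x]]|[/= -> _]]; last first.
  exists (T, y); first by right.
  by rewrite eucl_dist_horizontal subrr normr0 ltW.
rewrite /= in_itv/= => /andP[lx xt] <-.
have x0 : 0 <= x by exact: le_trans (left_lim_ge0 Phf t0) lx.
(* Conversely [u] is onto, so it attains every level [x] inside a jump of [f]. *)
have [s s0 us] := Phi_surj Phu x0; rewrite -us in lx xt *.
have st : `|t - s| <= e.
  by apply: (interleaved_times Phf Phu e0 fu) => //; rewrite tT.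
have [sT|Ts] := leP s T.
  exists (s, w (u s)); last by rewrite eucl_dist_horizontal.
  by left; split => //=; rewrite s0.
exists (T, w (u s)); first by right.
rewrite eucl_dist_horizontal (le_trans _ st)// !ler0_norm; lra.
Qed.

End hausdorff.

(** * The solutions for large n *)

Section fast_dynamics.
Context {R : realType}.
Variables (g : nat -> R * R -> R) (phi : nat -> R -> R).
Hypothesis hg : forall n, G (g n).
Hypothesis hg_cvg : norm_Rplus2 (fun p => g 0%N p - g n p) @[n --> \oo] --> 0%E.
Hypothesis hphi : forall n, (0 < n)%N ->
  Phi (phi n) /\ global_solution (fun p => n%:R * g n p) (phi n).
Local Notation f := (phibar0 (g 0%N)).
Implicit Types (r s t x c e T : R).

Lemma norm_Rplus2_cvg_box k e : 0 < e -> \forall n \near \oo,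
  forall t x, 0 <= t <= k -> 0 <= x <= k -> `|g 0%N (t, x) - g n (t, x)| <= e.
Proof.
(* The successor makes the box large enough and the index positive, as the series starts at 1. *)
move=> e0; pose K := (Num.truncn k).+1.
have kK : k <= K%:R by exact/ltW/truncnS_gt.
have a0 n k' : (0 <= ereal_sup [set `|g 0%N p - g n p|%:E |
    p in (`[0%R, k'%:R] `*` `[0%R, k'%:R])%classic])%E.
  apply: le_trans (ereal_sup_ubound _); last first.
    by exists (0, 0) => //; split; rewrite /= in_itv/= lexx ler0n.
  by rewrite lee_fin.
have := wsum_cvg0_pointwise a0 hg_cvg (ltn0Sn _ : (0 < K)%N) e0.
apply: filterS => n hn t x /andP[t0 tk] /andP[x0 xk].
rewrite -lee_fin; apply: le_trans hn; apply: ereal_sup_ubound.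
by exists (t, x) => //; split; rewrite /= in_itv/= ?t0 ?x0 (le_trans _ kK).
Qed.

Lemma solutions_eventually_below t c : 0 <= t -> f t < c ->
  \forall n \near \oo, phi n t < c.
Proof.
move=> t0 tc; have [x [x0 fx xc gx]] := phibar0_lt (hg 0%N) t0 tc.
(* With this tolerance g_n(t, x) <= g_0(t, x) / 2 < 0, so x is a barrier for the n-th solution
   too. *)
have e0 : 0 < - g 0%N (t, x) / 2 by rewrite divr_gt0// oppr_gt0.
apply: filterS2 (nbhs_infty_gt 0) (norm_Rplus2_cvg_box (Num.max t x) e0) => n n0.
move=> /(_ t x); rewrite t0 (ltW x0) !le_max !lexx orbT => /(_ isT isT).
rewrite distrC => /(le_trans (ler_norm _)) gn.
have [Pn sn] := hphi n0; have n0' : 0 < n%:R :> R by rewrite ltr0n.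
apply: lt_trans xc; apply: (solution_below_barrier (hg n) n0' Pn sn) => //.
  exact: ltW.
lra.
Qed.

(* On [r, t] with s < r < t, g_0 is bounded below by a positive constant on
   [0, f s], so that n g_n pushes the solution past f s before time t. *)
Lemma solutions_eventually_above s t : 0 <= s -> s < t ->
  \forall n \near \oo, f s < phi n t.
Proof.
move=> s0 st; pose r := (s + t) / 2; pose c := f s.
have sr : s < r by rewrite /r; lra.
have rt : r < t by rewrite /r; lra.
have r0 : 0 < r by exact: le_lt_trans sr.
have c0 : 0 <= c by exact: phibar0_ge0.
have cont : {within `[0, c], continuous (fun x => g 0%N (r, x))}.
  apply/subspace_continuousP => x /=; rewrite in_itv/= => /andP[x0 xc].
  apply/cvgrPdist_lt => e e0; have [d d0 hd] := G_near (hg 0%N) (ltW r0) x0 e0.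
  rewrite near_withinE; apply/nbhs_ballP; exists d => // y.
  rewrite /ball/= => xy; rewrite in_itv/= => /andP[y0 _].
  rewrite distrC; apply: hd => //; first exact: ltW.
    by rewrite subrr normr0.
  by rewrite distrC.
have [x xc xmin] := EVT_min c0 cont.
set m := g 0%N (r, x) in xmin.
(* At time s the function g_0 is nonnegative on [0, c], vanishing at the root c; strict growth up to
   time r makes it positive. *)
have m0 : 0 < m.
  move: xc; rewrite in_itv/= => /andP[x0].
  rewrite le_eqVlt => /predU1P[xc|xc].
    by rewrite -(phibar0_root (hg 0%N) s0) -/c -xc; exact: G_lt_time.
  exact: le_lt_trans (phibar0_below (hg 0%N) s0 x0 xc) (G_lt_time (hg 0%N) s0 sr x0).
have m20 : 0 < m / 2 by rewrite divr_gt0.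
have mtr : 0 < m / 2 * (t - r) by rewrite mulr_gt0// subr_gt0.
have box := norm_Rplus2_cvg_box (Num.max r c) m20.
(* Half of [m] absorbs the passage from g_0 to g_n; the threshold on [n] makes n (m / 2) (t - r)
   exceed c. *)
apply: filterS3 (nbhs_infty_gt 0) (nbhs_infty_gtr (c / (m / 2 * (t - r)))) box.
move=> n n0 nc gn.
have [Pn sn] := hphi n0; have n0' : 0 < n%:R :> R by rewrite ltr0n.
apply: (solution_above (hg n) n0' Pn sn r0 rt (ltW m20)); last first.
  by rewrite -[n%:R * _ * _]mulrA -ltr_pdivrMr.
move=> y /andP[y0 yc].
have gy : m <= g 0%N (r, y) by apply: xmin; rewrite in_itv/= y0.
have := gn r y; rewrite (ltW r0) y0 !le_max lexx yc orbT => /(_ isT isT).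
by move=> /(le_trans (ler_norm _)); lra.
Qed.

Lemma solutions_interleaved e T : 0 < e ->
  \forall n \near \oo, interleaved f (phi n) e T.
Proof.
(* Step e / 2 makes two grid steps equal to e: for t in [t_k, t_(k+1)) one has t <= t_(k+1) and
   t_(k+2) <= t + e, so comparing the paths at these two grid times suffices. *)
move=> e0; pose h := e / 2; pose tk (k : nat) := k%:R * h.
have h0 : 0 < h by rewrite divr_gt0.
have tk0 k : 0 <= tk k by rewrite mulr_ge0// ltW.
have tkS k : tk k.+1 = tk k + h by rewrite /tk -natr1 mulrDl mul1r.
have fmono := phibar0_lt_mono (hg 0%N).
have fle := phibar0_le_mono (hg 0%N).
have grid k : \forall n \near \oo,
    f (tk k.+1) < phi n (tk k.+2) /\ phi n (tk k.+1) < f (tk k.+2).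
  have tkk : tk k.+1 < tk k.+2 by rewrite (tkS k.+1) ltrDl.
  apply: filterS2 (solutions_eventually_above (tk0 k.+1) tkk)
    (solutions_eventually_below (tk0 k.+1) (fmono _ _ (tk0 _) tkk)) => n.
  by split.
have := near_leq grid (Num.truncn (T / h)).
apply: filterS2 (nbhs_infty_gt 0) => n n0 gridn t /andP[t0 tT].
have [Pn _] := hphi n0.
have ule x y : 0 <= x -> x <= y -> phi n x <= phi n y.
  move=> x0; rewrite le_eqVlt => /predU1P[->//|xy].
  apply/ltW/(Phi_lt_mono Pn) => //; rewrite inE//.
  exact: le_trans (ltW xy).
have th0 : 0 <= t / h by rewrite divr_ge0// ltW.
have kT : (Num.truncn (t / h) <= Num.truncn (T / h))%N.
  by apply: le_truncn; rewrite ler_pM2r// invr_gt0.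
have := truncn_itv th0; set k := Num.truncn _ in kT *.
rewrite ler_pdivlMr// ltr_pdivrMr// -/(tk k) -/(tk k.+1) => /andP[kt tk1].
have te : tk k.+2 <= t + e by rewrite !tkS /h; lra.
have [lo up] := gridn k kT; split.
  apply: le_trans (fle _ _ t0 (ltW tk1)) _.
  exact: le_trans (ltW lo) (ule _ _ (tk0 _) te).
apply: le_trans (ule _ _ t0 (ltW tk1)) _.
exact: le_trans (ltW up) (fle _ _ (tk0 _) te).
Qed.

End fast_dynamics.

Theorem mainTheorem10 (R : realType)
    (g : nat -> R * R -> R) (phi : nat -> R -> R) (w : R -> R)
    (hg : forall n, G (g n))
    (hg_cvg : norm_Rplus2 (fun p => g 0%N p - g n p) @[n --> \oo] --> 0%E)
    (hphi : forall n, (0 < n)%N ->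
       Phi (phi n) /\ global_solution (fun p => n%:R * g n p) (phi n))
    (hw : C_Rplus w) :
  let eps := fun n t => [set w (phi n t)] in
  let eps0 := bullet w (phibar0 (g 0%N)) in
  [/\ Phibar (phibar0 (g 0%N)),
      dPhibar (phi n) (phibar0 (g 0%N)) @[n --> \oo] --> 0%E,
      forall n, (0 < n)%N -> E (eps n),
      E eps0
    & dE (eps n) eps0 @[n --> \oo] --> 0%E].
Proof.
move=> eps eps0; have Phf := phibar0_Phibar (hg 0%N).
split => //.
- apply: wsum_cvg0 => [n k|k e e0].
    apply: le_trans (ereal_sup_ubound _); last first.
      by exists 0 => //; rewrite /= in_itv/= lexx ler0n.
    by rewrite lee_fin.
  (* All levels in [0, k] lie below [f T], so interleaving up to [T] controls both inverses
     there. *)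
  have [T T0 kT] := Phibar_unbounded Phf k%:R.
  apply: filterS2 (nbhs_infty_gt 0) (solutions_interleaved hg hg_cvg hphi T e0).
  move=> n n0 fu; apply: ge_ereal_sup => _ [x + <-].
  rewrite /= in_itv/= => /andP[x0 xk]; rewrite lee_fin.
  exact: (interleaved_Einv e0 T0 fu x0 (le_lt_trans xk kT)).
- move=> n _ t _; split; first by exists (w (phi n t)).
    exact: compact_set1.
  by move=> x y -> -> z /le_anti <-.
(* The value at t is the image of a segment under a continuous map, hence compact and connected. *)
- move=> t t0; have lf := left_lim_le_self Phf t0.
  have wc : {within `[left_lim (phibar0 (g 0%N)) t, phibar0 (g 0%N) t],
      continuous w}.
    apply: continuous_subspaceW hw => x; rewrite /= in_itv/= => /andP[+ _].
    exact: le_trans (left_lim_ge0 Phf t0).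
  split.
  + exists (w (phibar0 (g 0%N) t)), (phibar0 (g 0%N) t) => //=.
    by rewrite in_itv/= lf lexx.
  + exact: continuous_compact wc (@segment_compact _ _ _).
  + apply/connected_intervalP.
    exact: connected_continuous_connected (@segment_connected _ _ _) wc.
- apply: wsum_cvg0 => [n k|k e e0]; first exact: dET_ge0.
  have fu := solutions_interleaved hg hg_cvg hphi k%:R e0.
  apply: filterS2 (nbhs_infty_gt 0) fu => n n0 fu.
  have [Pn _] := hphi n n0.
  exact: dET_interleaved Phf Pn e0 (ler0n _ _) fu.
Qed.
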